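(* Let $\eta$ be a local configuration of radius $r>0$ with $k(\eta)\ge 1$ positive vertices and perimeter $\gamma(\eta)$. Let $c>0$ be a constant, let $b$ be an arbitrary real number, and let the magnetic field $a=a(n)$ be defined by $e^{2a(n)}=c\,n^{-d/k(\eta)}$. Then, as $n\to\infty$, the distribution of $X_n(\eta)$ under the Ising measure $\mu_{a(n),b}$ on $\{-1,+1\}^{V_n}$ converges weakly to the Poisson distribution with parameter $c^{k(\eta)}e^{-2b\gamma(\eta)}$.
   Context: Fix an integer $d\ge 1$, $p\in[1,\infty]$ and a real $\rho>0$. For an integer $n\ge 1$, $G_n=(V_n,E_n)$ is the graph (lattice torus) with vertex set $V_n=\{0,\dots,n-1\}^d$ (operations on vertices taken componentwise modulo $n$), where two distinct vertices $x,y$ are joined by an edge iff $\|y-x\|_p\le\rho$, the difference being taken componentwise modulo $n$ (each coordinate represented by its residue of minimal absolute value). All vertices have the same number of neighbors, denoted $\mathcal V$. Ising model: for reals $a,b$, $\mu_{a,b}$ is the probability measure on $\mathcal X_n=\{-1,+1\}^{V_n}$ with $$\mu_{a,b}(\sigma)=\frac1{Z_{a,b}}\exp\Big(a\sum_{x\in V_n}\sigma(x)+b\sum_{\{x,y\}\in E_n}\sigma(x)\sigma(y)\Big),$$ where $Z_{a,b}$ is the normalizing constant. $dist$ is the graph distance and $B(x,r)=\{y\in V_n: dist(x,y)\le r\}$. Only sizes $n>2\rho(r+1)$ are considered; then the balls $B(0,r)$ for different $n$, with their induced graph structure, are canonically identified. A local configuration of radius $r$ is an element $\eta\in\mathcal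 D_r=\{-1,+1\}^{B(0,r)}$ (fixed, not depending on $n$). Put $V_+(\eta)=\{x\in B(0,r):\eta(x)=+1\}$ and $k(\eta)=|V_+(\eta)|$. The perimeter is $$\gamma(\eta)=\mathcal V\,|V_+(\eta)|-2\,\big|\{\{x,y\}\in E_n: x,y\in V_+(\eta)\}\big|,$$ which does not depend on $n$. For $x\in V_n$, $\eta_x$ is the translate of $\eta$ to $B(x,r)$: $\eta_x(x+y)=\eta(y)$ for $y\in B(0,r)$. $I_x^\eta(\sigma)=1$ if the restriction of $\sigma\in\mathcal X_n$ to $B(x,r)$ equals $\eta_x$, and $0$ otherwise. $X_n(\eta)=\sum_{x\in V_n}I_x^\eta$ is the number of copies of $\eta$ in $G_n$. *)

(* Defs.v *)
From HB Require Import structures.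
From mathcomp Require Import all_boot all_order all_algebra.
From mathcomp Require Import all_classical all_reals all_analysis.
Import Order.TTheory GRing.Theory Num.Theory.
Import numFieldNormedType.Exports.

Set Implicit Arguments.
Unset Strict Implicit.
Unset Printing Implicit Defensive.

Local Open Scope ring_scope.

(* For n >= 1 this is {0, .., n-1}^d, with the componentwise addition modulo n
   as its group law; n.-1.+1 makes 'I_n a group type. n = 0 is junk. *)
Notation torus d n := {ffun 'I_d -> 'I_n.-1.+1}.

(* The representative of minimal absolute value of a residue modulo n. *)
Definition minres (n : nat) (z : 'I_n.-1.+1) : int :=
  if (z.*2 <= n)%N then z%:Z else z%:Z - n%:Z.

Definition lpnorm (R : realType) (p : \bar R) (d : nat) (v : 'I_d -> R) : R :=
  match p with
  | q%:E => (\sum_(i < d) `|v i| `^ q) `^ q^-1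
  | +oo%E => \big[Num.max/0]_(i < d) `|v i|
  | -oo%E => 0
  end.

Section torus_graph.
Context {R : realType} (p : \bar R) (rho : R) {d n : nat}.
Implicit Types x y : torus d n.

Definition adj : rel (torus d n) :=
  fun x y => (x != y) &&
    (lpnorm p (fun i => (minres ((y - x) i))%:~R) <= rho).

Definition edges : {set {set torus d n}} :=
  [set [set e.1; e.2] | e : torus d n * torus d n & adj e.1 e.2]%SET.

Definition degree x : nat := #|[set y | adj x y]%SET|.

(* +oo between vertices in different connected components. *)
Definition gdist x y : \bar R :=
  ereal_inf [set (size s)%:R%:E |
    s in [set s : seq (torus d n) | path adj x s /\ last x s = y]]%classic.

Definition gball x (r : nat) : {set torus d n} :=
  [set y | (gdist x y <= r%:R%:E)%E]%SET.

End torus_graph.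

(* Spin configurations; true stands for +1 and false for -1. *)
Definition config (d n : nat) : Type := {ffun torus d n -> bool}.

HB.instance Definition _ d n := Finite.on (config d n).
HB.instance Definition _ d n := isPointed.Build (config d n) [ffun=> false].
HB.instance Definition _ d n := @isMeasurable.Build default_measure_display
  (config d n) discrete_measurable discrete_measurable0
  discrete_measurableC discrete_measurableU.

Definition spin (R : realType) (s : bool) : R := if s then 1 else -1.

Section ising.
Context {R : realType} (p : \bar R) (rho : R) (d n : nat) (a b : R).

Definition ising_weight (s : {ffun torus d n -> bool}) : R :=
  expR (a * (\sum_(x : torus d n) spin R (s x)) +
        b * (\sum_(e in edges p rho) \prod_(x in e) spin R (s x))).

Definition ising_Z : R := \sum_(s : {ffun torus d n -> bool}) ising_weight s.

Definition ising (A : set (config d n)) : \bar R :=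
  (\sum_(s : {ffun torus d n -> bool} | s \in A) ising_weight s / ising_Z)%:E.

Let ising_Z_gt0 : 0 < ising_Z.
Proof.
rewrite /ising_Z (bigD1 [ffun=> false]) //= ltr_pwDl ?expR_gt0 //.
by apply: sumr_ge0 => s _; exact: expR_ge0.
Qed.

Let mass_ge0 s : 0 <= ising_weight s / ising_Z.
Proof. by rewrite divr_ge0 ?expR_ge0 // ltW. Qed.

Let ising0 : ising set0 = 0%E.
Proof. by rewrite /ising big1 // => s; rewrite in_set0. Qed.

Let ising_ge0 A : (0 <= ising A)%E.
Proof. by rewrite lee_fin; apply: sumr_ge0 => s _. Qed.

Let ising_sigma_additive : semi_sigma_additive ising.
Proof.
pose m (k : nat) : {measure set (config d n) -> \bar R} :=
  let s := nth ([ffun=> false] : config d n) (enum {: config d n}) k in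
  mscale (NngNum (mass_ge0 s)) (\d_s).
suff -> : ising = msum m #|{: config d n}| by exact: measure_semi_sigma_additive.
apply/funext => A; rewrite /ising /msum -sumEFin.
rewrite -(big_mkord xpredT (fun k => m k A)) cardE.
rewrite -[RHS](big_nth ([ffun=> false] : config d n) xpredT
  (fun s => ((ising_weight s / ising_Z)%:E * \d_s A)%E)) big_enum /=.
rewrite big_mkcond /=; apply: eq_bigr => s _.
by rewrite diracE; case: (s \in A); rewrite ?mule1 ?mule0.
Qed.

HB.instance Definition _ := isMeasure.Build _ _ _ ising
  ising0 ising_ge0 ising_sigma_additive.

Let ising_setT : ising [set: config d n] = 1%E.
Proof.
rewrite /ising; congr EFin; under eq_bigl do rewrite in_setT.
by rewrite -mulr_suml mulfV // gt_eqF.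
Qed.

HB.instance Definition _ :=
  @Measure_isProbability.Build _ _ R ising ising_setT.

End ising.
Arguments ising {R} p rho d n a b A.

(* Balls of radius r in the tori of sizes n > 2 rho (r + 1) are identified with
   one another by taking representatives of minimal absolute value. A local
   configuration is given on the ball of an arbitrary torus of such a size n0,
   and transported to the torus of size n by recenter. *)
Definition recenter (d n0 n : nat) (y : torus d n0) : torus d n :=
  [ffun i => inZp `|(minres (y i) %% n%:Z)%Z|%N].

Section local_configuration.
Context {R : realType} (p : \bar R) (rho : R) (d n0 r : nat).

Definition local_config : Type :=
  {ffun {y : torus d n0 | y \in gball p rho 0 r} -> bool}.

Variable eta : local_config.

Definition vplus : {set torus d n0} :=
  [set val y | y : {y : torus d n0 | y \in gball p rho 0 r} & eta y]%SET.

Definition kplus : nat := #|vplus|.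

Definition perimeter : int :=
  (degree p rho (0 : torus d n0))%:Z * kplus%:Z -
  2 * #|[set e in edges p rho | e \subset vplus]%SET|%:Z.

Section copies.
Variable n : nat.

Definition occurs (x : torus d n) (s : {ffun torus d n -> bool}) : bool :=
  [forall y : {y : torus d n0 | y \in gball p rho 0 r},
    s (x + recenter n (val y)) == eta y].

Definition copies (s : config d n) : R := \sum_(x : torus d n) (occurs x s)%:R.

Let measurable_copies : measurable_fun [set: config d n] copies.
Proof. by []. Qed.

HB.instance Definition _ :=
  isMeasurableFun.Build _ _ _ _ copies measurable_copies.

End copies.
End local_configuration.
Arguments kplus {R p rho d n0 r} eta.
Arguments perimeter {R p rho d n0 r} eta.
Arguments copies {R p rho d n0 r} eta n s.

Section weak_convergence.
Context {R : realType}.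

(* Convergence of the integrals of all bounded continuous functions. *)
Definition weak_cvg (mu : nat -> probability R R) (nu : probability R R) : Prop :=
  forall f : R -> R, continuous f -> [bounded f x | x in [set: R]%classic] ->
    (\int[mu n]_x f x @[n --> \oo] --> \int[nu]_x f x)%classic.

Definition nat_to_real (k : nat) : R := k%:R.

Let measurable_nat_to_real : measurable_fun [set: nat] nat_to_real.
Proof. by []. Qed.

HB.instance Definition _ :=
  isMeasurableFun.Build _ _ _ _ nat_to_real measurable_nat_to_real.

(* The library's Poisson law lives on nat, and has a spurious argument in nat. *)
Definition poisson (lambda : R) : probability R R :=
  distribution (poisson_prob lambda 0) nat_to_real.

End weak_convergence.

(* Main.v *)
(* Chen-Stein identity. Erasing one copy of eta whose surroundings are otherwise
   negative divides the Ising weight by e^(2ak - 2b gamma) = lambda / n^d and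
   lowers X_n by exactly one. Summing over the n^d possible positions gives
   (j + 1) P(X_n = j + 1) - lambda P(X_n = j) -> 0 for every j, because
   configurations with an additional positive spin near the copy are negligible:
   flipping a positive spin multiplies the weight by at most C e^(2a), so fixed
   sites S are all positive with probability at most (C e^(2a))^|S|. Together
   with the tightness that follows from the boundedness of E X_n, the recursion
   forces P(X_n = j) to converge to the Poisson masses, hence weak convergence. *)
Require Import Defs.
From HB Require Import structures.
From mathcomp Require Import all_boot all_order all_algebra.
From mathcomp Require Import all_classical all_reals all_analysis.
From mathcomp Require Import measurable_realfun ring lra zify.
Import Order.TTheory GRing.Theory Num.Theory.
Import numFieldNormedType.Exports.

Set Implicit Arguments.
Unset Strict Implicit.
Unset Printing Implicit Defensive.

Local Open Scope ring_scope.

(** * Weak convergence to the Poisson law *)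

(** The delicate point is that erasing a copy lowers the count by exactly one: copies may overlap,
    and erasing could create new ones. Both are excluded by prescribing the spins on a window that
    holds every ball meeting the erased copy. After the erasure this window is entirely negative,
    whereas a copy has a positive site. Before it, a second copy there would place a translate of
    the positive set inside that set, hence equal to it. On a torus a nonzero translation can
    preserve a set; n > 6 r rho rules this out. The errors are explicit for each large n. With q = C
    e^(2a), a copy in a dirty window forces k + 1 positive sites, in total order n^d q^(k+1), and a
    window that is not vacant costs order lambda q. Since n^d q^k is constant in n, both are of
    order q. Using |b| in C makes the bounds valid for either sign of b. *)

Lemma cvg_sum_ord (R : realType) (J : nat) (f : nat -> nat -> R) (l : nat -> R) :
  (forall j, (j < J)%N -> (f j n @[n --> \oo] --> l j)%classic) ->
  (\sum_(j < J) f j n @[n --> \oo] --> \sum_(j < J) l j)%classic.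
Proof.
elim: J => [|J ih] h.
  by under eq_fun do rewrite big_ord0; rewrite big_ord0; exact: cvg_cst.
under eq_fun do rewrite big_ord_recr.
rewrite big_ord_recr; apply: cvgD; last exact: h.
by apply: ih => j /ltnW; exact: h.
Qed.

(** First [J] is fixed to make [al J] small, then [n] grows; both the rate of [be J] and the
    threshold in [n] may depend on [J]. *)
Lemma cvg0_diag (R : realType) (u al : nat -> R) (be : nat -> nat -> R) :
  (al @ \oo --> (0 : R))%classic ->
  (forall J, (be J @ \oo --> (0 : R))%classic) ->
  (forall J, \forall n \near \oo%classic, `|u n| <= al J + be J n) ->
  (u @ \oo --> (0 : R))%classic.
Proof.
move=> hal hbe hu; apply/cvgrPdist_le => e e0.
have e20 : 0 < e / 2 by rewrite divr_gt0.
have [J _ hJ] : \forall J \near \oo%classic, `|0 - al J| <= e / 2.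
  by move/cvgrPdist_le : hal => /(_ _ e20).
have hJJ : `|0 - al J| <= e / 2 by apply: hJ => /=.
have hbJ : \forall n \near \oo%classic, `|0 - be J n| <= e / 2.
  by move/cvgrPdist_le : (hbe J) => /(_ _ e20).
near=> n.
have h1 : `|u n| <= al J + be J n by near: n; exact: hu.
have h2 : `|0 - be J n| <= e / 2 by near: n.
rewrite sub0r normrN in hJJ; rewrite sub0r normrN in h2.
rewrite sub0r normrN (le_trans h1)//.
have := ler_norm (al J); have := ler_norm (be J n); lra.
Unshelve. all: by end_near. Qed.

Definition mass (R : realType) (mu : probability R R) (j : nat) : R :=
  fine (mu [set j%:R]%classic).

Lemma massE (R : realType) (mu : probability R R) (j : nat) :
  mu [set j%:R]%classic = (mass mu j)%:E.
Proof. by rewrite fineK// fin_num_measure. Qed.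

Lemma mass_ge0 (R : realType) (mu : probability R R) (j : nat) : 0 <= mass mu j.
Proof. by rewrite fine_ge0. Qed.

(** The integral over the points 0, ..., J - 1 is the finite sum. On the complement only the bound
    [F] is available, and total mass one gives the measure of that set. *)
Lemma dist_Rintegral_masses (R : realType) (mu : probability R R) (f : R -> R)
    (F : R) (J : nat) :
  measurable_fun [set: R]%classic f -> (forall x, `|f x| <= F) ->
  `|\int[mu]_x f x - \sum_(j < J) mass mu j * f j%:R|
    <= F * (1 - \sum_(j < J) mass mu j).
Proof.
move=> mf hF.
have F0 : 0 <= F by apply: le_trans (hF 0).
have intF D : (measurable D -> mu.-integrable D (EFin \o f))%classic.
  move=> mD.
  apply: (@le_integrable _ _ _ _ _ mD _ (cst F%:E)).
  - by apply/measurable_EFinP; exact: measurable_funS mf.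
  - by move=> x _; rewrite /= lee_fin (le_trans (hF x))// ler_norm.
  - exact: finite_measure_integrable_cst.
pose A := fun k : nat => [set x : R | exists2 j, (j < k)%N & x = j%:R]%classic.
have AS k : A k.+1 = (A k `|` [set k%:R])%classic.
  apply/seteqP; split => x /=.
    move=> [j]; rewrite ltnS leq_eqVlt => /orP[/eqP-> ->|jk ->]; first by right.
    by left; exists j.
  by move=> [[j jk ->]|->]; [exists j => //; exact: ltnW|exists k].
have A0 : A 0%N = set0 by apply/seteqP; split => x // [].
have mA k : measurable (A k).
  by elim: k => [|k ih]; rewrite ?A0// AS; exact: measurableU.
have dA k : [disjoint A k & [set k%:R]]%classic.
  apply/disj_set2P/seteqP; split => x // [[j jk ->]] /= /eqP.
  by rewrite eqr_nat => /eqP jk'; rewrite jk' ltnn in jk.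
have IA k : \int[mu]_(x in A k) f x = \sum_(j < k) mass mu j * f j%:R.
  elim: k => [|k ih]; first by rewrite A0 Rintegral_set0 big_ord0.
  rewrite AS Rintegral_setU//; last by rewrite -AS; exact: intF.
  rewrite ih big_ord_recr/=; congr (_ + _).
  rewrite (@eq_Rintegral _ _ _ _ _ (cst (f k%:R))).
    by rewrite Rintegral_cst// mulrC.
  by move=> x; rewrite inE => ->.
have PA k : mu (A k) = (\sum_(j < k) mass mu j)%:E.
  elim: k => [|k ih]; first by rewrite A0 measure0 big_ord0.
  rewrite AS measureU//; last by apply/disj_set2P.
  by move: ih => /= ih; rewrite big_ord_recr/= EFinD -massE -ih.
have PC : mu (~` A J)%classic = (1 - \sum_(j < J) mass mu j)%:E.
  by rewrite probability_setC// PA EFinB.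
have -> : \int[mu]_x f x = \int[mu]_(x in A J) f x + \int[mu]_(x in ~` A J) f x.
  rewrite -Rintegral_setU ?setUCr//; [exact: measurableC| |].
  - exact: intF.
  - by apply/disj_set2P; rewrite setICr.
rewrite IA addrC addKr.
have mC : measurable (~` A J)%classic by exact: measurableC.
apply: (le_trans (le_normr_Rintegral mC (intF _ mC))).
apply: (@le_trans _ _ (\int[mu]_(x in ~` A J) F)).
  apply: le_Rintegral => //; first exact/integrable_norm/intF.
  exact: finite_measure_integrable_cst.
by rewrite Rintegral_cst//; move: PC => /= ->.
Qed.

(** Since the limit masses sum to one, no mass escapes: what [mu n] puts off 0, ..., J - 1 converges
    to what [nu] puts there, which is small for large [J]. *)
Lemma weak_cvg_masses (R : realType) (mu : nat -> probability R R)
    (nu : probability R R) :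
  (forall j, (mass (mu n) j @[n --> \oo] --> mass nu j)%classic) ->
  (\sum_(j < J) mass nu j @[J --> \oo] --> (1 : R))%classic ->
  weak_cvg mu nu.
Proof.
move=> hj hs f cf [M [_ bf]].
pose F : R := `|M| + 1.
have hF x : `|f x| <= F.
  by apply: bf => //; rewrite /F ltr_pwDr// ler_norm.
have F0 : 0 <= F by rewrite addr_ge0.
have mf : measurable_fun [set: R]%classic f by exact: continuous_measurable_fun.
apply/subr_cvg0.
pose s (m : probability R R) J := \sum_(j < J) mass m j.
pose t (m : probability R R) J := \sum_(j < J) mass m j * f j%:R.
(* The tail of [mu n] is rewritten as the tail of [nu] plus [s nu J - s (mu n) J]. The tail of [nu]
   thus occurs twice, whence the factor 2. *)
apply: (@cvg0_diag _ _ (fun J => F * (1 - s nu J) * 2)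
  (fun J n => F * (s nu J - s (mu n) J) + `|t (mu n) J - t nu J|)).
- rewrite (_ : 0 = F * (1 - 1) * 2); last by ring.
  apply: cvgM; last exact: cvg_cst.
  by apply: cvgM; [exact: cvg_cst|apply: cvgB => //; exact: cvg_cst].
- move=> J; have -> : (0 : R) = F * (s nu J - s nu J) + `|t nu J - t nu J|.
    by rewrite !subrr mulr0 normr0 addr0.
  apply: cvgD.
    apply: cvgM; first exact: cvg_cst.
    apply: cvgB; first exact: cvg_cst.
    apply: (@cvg_sum_ord _ J (fun j n => mass (mu n) j) (mass nu)) => j _.
    exact: hj.
  apply: cvg_norm; apply: cvgB; last exact: cvg_cst.
  apply: (@cvg_sum_ord _ J (fun j n => mass (mu n) j * f j%:R)
    (fun j => mass nu j * f j%:R)) => j _.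
  by apply: cvgM; [exact: hj|exact: cvg_cst].
- move=> J; near=> n.
  have h1 := dist_Rintegral_masses (mu n) J mf hF.
  have h2 := dist_Rintegral_masses nu J mf hF.
  rewrite -/(t (mu n) J) -/(s (mu n) J) in h1; rewrite -/(t nu J) -/(s nu J) in h2.
  set a := \int[mu n]_x f x in h1 *; set b := \int[nu]_x f x in h2 *.
  have -> : a - b = (a - t (mu n) J) + (t (mu n) J - t nu J) + (t nu J - b) by ring.
  apply: (le_trans (ler_normD _ _)); rewrite [`|t nu J - b|]distrC.
  have := ler_normD (a - t (mu n) J) (t (mu n) J - t nu J).
  lra.
Unshelve. all: by end_near. Qed.

Lemma mass_poisson (R : realType) (la : R) (j : nat) : 0 < la ->
  mass (poisson la) j = la ^+ j / j`!%:R * expR (- la).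
Proof.
move=> la0; have pre : (@nat_to_real R @^-1` [set j%:R] = [set j])%classic.
  apply/seteqP; split => i /=; rewrite /nat_to_real; last by move=> ->.
  by move/eqP; rewrite eqr_nat => /eqP.
rewrite /mass (_ : poisson la [set j%:R]%classic = poisson_prob la 0 [set j]%classic).
  by rewrite /poisson_prob la0 esum_set1 /= ?lee_fin ?poisson_pmf_ge0// /poisson_pmf la0.
by rewrite -pre.
Qed.

Lemma cvg_exp_series (R : realType) (la : R) :
  (\sum_(j < J) la ^+ j / j`!%:R @[J --> \oo] --> expR la)%classic.
Proof.
rewrite (_ : (fun J => _) = series (exp_coeff la)); first exact: is_cvg_series_exp_coeff.
by apply/funext => J; rewrite /series /= big_mkord.
Qed.

Lemma sum_mass_poisson (R : realType) (la : R) : 0 < la ->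
  (\sum_(j < J) mass (poisson la) j @[J --> \oo] --> (1 : R))%classic.
Proof.
move=> la0; rewrite (_ : 1 = expR la * expR (- la)); last first.
  by rewrite -expRD subrr expR0.
under eq_fun => J.
  under eq_bigr => j _ do rewrite mass_poisson//.
  rewrite -mulr_suml; over.
by apply: cvgM; [exact: cvg_exp_series|exact: cvg_cst].
Qed.

(* The Chen-Stein equation of the Poisson law determines the masses up to the
   factor P n 0, which tightness then identifies. *)
Lemma poisson_cvg_of_recursion (R : realType) (la : R) (P : nat -> nat -> R)
    (C : R) :
  0 < la -> (forall n j, 0 <= P n j) ->
  (forall n J, \sum_(j < J) P n j <= 1) ->
  (forall J, \forall n \near \oo%classic,
     1 - \sum_(j < J) P n j <= C / J.+1%:R) ->
  (forall j, (j.+1%:R * P n j.+1 - la * P n j @[n --> \oo] --> (0 : R))%classic) ->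
  forall j, (P n j @[n --> \oo] --> la ^+ j / j`!%:R * expR (- la))%classic.
Proof.
move=> la0 P0 P1 PC Prec.
have hrec j : (P n j - la ^+ j / j`!%:R * P n 0%N @[n --> \oo] --> (0 : R))%classic.
  elim: j => [|j ih].
    rewrite (_ : (fun n => _) = cst 0); first exact: cvg_cst.
    by apply/funext => n /=; rewrite expr0 fact0 divr1 mul1r subrr.
  have -> : (0 : R) = j.+1%:R^-1 * 0 + la / j.+1%:R * 0 by ring.
  rewrite (_ : (fun n => _) = (fun n => j.+1%:R^-1 * (j.+1%:R * P n j.+1 - la * P n j)
    + la / j.+1%:R * (P n j - la ^+ j / j`!%:R * P n 0%N))).
    by apply: cvgD; apply: cvgM; [exact: cvg_cst|exact: Prec|exact: cvg_cst|].
  apply/funext => n; rewrite exprS factS natrM.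
  have : (j.+1%:R != 0 :> R) by rewrite pnatr_eq0.
  have : (j`!%:R != 0 :> R) by rewrite pnatr_eq0 -lt0n fact_gt0.
  move: (j.+1%:R : R) (j`!%:R : R) => x y y0 x0.
  by field; rewrite x0 y0.
pose S J : R := \sum_(j < J) la ^+ j / j`!%:R.
have SP J : (\sum_(j < J) P n j - S J * P n 0%N @[n --> \oo] --> (0 : R))%classic.
  rewrite (_ : (fun n => _) =
      (fun n => \sum_(j < J) (P n j - la ^+ j / j`!%:R * P n 0%N))).
    have := @cvg_sum_ord _ J (fun j n => P n j - la ^+ j / j`!%:R * P n 0%N)
      (fun _ => 0) (fun j _ => hrec j).
    by rewrite big1.
  by apply/funext => n; rewrite sumrB mulr_suml.
have h0 : (P n 0%N * expR la - 1 @[n --> \oo] --> (0 : R))%classic.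
  apply: (@cvg0_diag _ _ (fun J => `|expR la - S J| + C * (J.+1%:R)^-1)
     (fun J n => `|\sum_(j < J) P n j - S J * P n 0%N|)).
  - rewrite (_ : 0 = `|expR la - expR la| + C * 0); last first.
      by rewrite subrr normr0 mulr0 addr0.
    apply: cvgD.
      by apply: cvg_norm; apply: cvgB; [exact: cvg_cst|exact: cvg_exp_series].
    by apply: cvgM; [exact: cvg_cst|exact: cvg_harmonic].
  - move=> J; have := cvg_norm (SP J); rewrite normr0; exact.
  - move=> J; near=> n.
    have h1 : 1 - \sum_(j < J) P n j <= C / J.+1%:R by near: n; exact: PC.
    have h2 : P n 0%N <= 1 by have := P1 n 1%N; rewrite big_ord1.
    (* Three errors: the truncation of the exponential series, the defect of proportionality to
       [P n 0] summed over j < J, and the tail, which [PC] bounds. *)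
    have -> : P n 0%N * expR la - 1 = P n 0%N * (expR la - S J)
      - (\sum_(j < J) P n j - S J * P n 0%N) - (1 - \sum_(j < J) P n j) by ring.
    apply: (le_trans (ler_normB _ _)).
    have := ler_normB (P n 0%N * (expR la - S J)) (\sum_(j < J) P n j - S J * P n 0%N).
    rewrite normrM (ger0_norm (P0 n 0%N)).
    rewrite [`|1 - _|]ger0_norm ?subr_ge0//.
    have : P n 0%N * `|expR la - S J| <= `|expR la - S J| by rewrite ler_piMl.
    by move=> q1 q2; apply: le_trans (lerD q2 h1) _; rewrite addrAC !lerD2r.
have h0' : (P n 0%N @[n --> \oo] --> expR (- la))%classic.
  rewrite (_ : expR (- la) = expR (- la) * (0 + 1)); last by rewrite add0r mulr1.
  rewrite (_ : (fun n => _) = fun n => expR (- la) * ((P n 0%N * expR la - 1) + 1)).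
    by apply: cvgM; [exact: cvg_cst|apply: cvgD => //; exact: cvg_cst].
  by apply/funext => n; rewrite subrK mulrCA -expRD addNr expR0 mulr1.
move=> j.
rewrite (_ : (fun n => _) = (fun n => (P n j - la ^+ j / j`!%:R * P n 0%N)
   + la ^+ j / j`!%:R * P n 0%N)).
  rewrite -[X in (_ --> X)%classic]add0r; apply: cvgD; first exact: hrec.
  by apply: cvgM; [exact: cvg_cst|].
by apply/funext => n; rewrite subrK.
Unshelve. all: by end_near. Qed.
(** * Energy of spin configurations on a finite graph *)

Section finite_graph.
Variables (R : realType) (T : finType) (e : rel T).
Hypotheses (e_irr : irreflexive e) (e_sym : symmetric e).
Implicit Types (x y u : T) (S A : {set T}) (s t : {ffun T -> bool}).

Local Notation graph_edges := [set [set q.1; q.2] | q : T * T & e q.1 q.2]%SET.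

(** An edge is the image of exactly two ordered pairs, distinct because [e] is irreflexive. Sums
    over ordered pairs can then be treated one vertex at a time. *)
Lemma sum_edges (F : {set T} -> R) :
  2 * (\sum_(A in graph_edges) F A) = \sum_x \sum_(y | e x y) F [set x; y]%SET.
Proof.
rewrite pair_big_dep /=.
rewrite (partition_big (fun q => [set q.1; q.2]%SET) (mem graph_edges)) /=; last first.
  by move=> q eq; apply/imsetP; exists q; rewrite ?inE.
rewrite mulr_sumr; apply: eq_bigr => A /imsetP[[x y]]; rewrite inE /= => exy ->{A}.
have nxy : x != y by apply: contraTneq exy => ->; rewrite e_irr.
have nxyp : (x, y) != (y, x) by apply: contraNneq nxy => -[->].
rewrite (bigD1 (x, y)) /=; last by rewrite exy eqxx.
rewrite (bigD1 (y, x)) /=; last by rewrite e_sym exy finset.setUC eqxx eq_sym nxyp.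
rewrite big1 ?addr0; last first.
  move=> -[u v] /= /andP[/andP[/andP[euv /eqP E] n1] n2].
  have : u \in [set x; y]%SET by rewrite -E !inE eqxx.
  have : v \in [set x; y]%SET by rewrite -E !inE eqxx orbT.
  have nuv : u != v by apply: contraTneq euv => ->; rewrite e_irr.
  rewrite !inE => /orP[] /eqP vE /orP[] /eqP uE; subst u v.
  - by rewrite eqxx in nuv.
  - by rewrite eqxx in n2.
  - by rewrite eqxx in n1.
  - by rewrite eqxx in nuv.
by rewrite [[set y; x]%SET]finset.setUC mulrDl mul1r.
Qed.

Lemma sum_edges_spin s :
  2 * (\sum_(A in graph_edges) \prod_(x in A) spin R (s x))
    = \sum_x \sum_(y | e x y) spin R (s x) * spin R (s y).
Proof.
rewrite sum_edges; apply: eq_bigr => x _; apply: eq_bigr => y exy.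
rewrite big_setU1 ?big_set1// inE; apply: contraTneq exy => ->.
by rewrite e_irr.
Qed.

(** The form in which edge counts are transported: degrees inside [S] follow any injection of the
    vertices that preserves adjacency. *)
Lemma card_edges_in S :
  2 * #|[set A in graph_edges | A \subset S]%SET|%:R
    = \sum_(x in S) #|[set y in S | e x y]%SET|%:R :> R.
Proof.
rewrite -sum1_card natr_sum.
under eq_bigl do rewrite inE.
rewrite big_mkcondr /= sum_edges [RHS]big_mkcond /=.
apply: eq_bigr => x _; case: ifP => xS; last first.
  by rewrite big1// => y _; rewrite finset.subUset finset.sub1set xS.
rewrite -sum1_card natr_sum [RHS]big_mkcond [LHS]big_mkcond /=.
apply: eq_bigr => y _; rewrite inE finset.subUset !finset.sub1set xS.
by case: (e x y); case: (y \in S).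
Qed.

Definition unset S s : {ffun T -> bool} := [ffun x => s x && (x \notin S)].

Lemma spin_unset_in S s x : x \in S -> spin R (unset S s x) = -1.
Proof. by move=> xS; rewrite ffunE xS andbF. Qed.

Lemma unset_notin S s x : x \notin S -> unset S s x = s x.
Proof. by move=> xS; rewrite ffunE xS andbT. Qed.

Lemma sum_spin_unset S s : (forall x, x \in S -> s x) ->
  \sum_x spin R (s x) = \sum_x spin R (unset S s x) + 2 * #|S|%:R.
Proof.
move=> sS; rewrite -sum1_card natr_sum mulr_sumr [in X in _ + X]big_mkcond -big_split.
apply: eq_bigr => x _ /=; case: ifPn => xS.
  by rewrite spin_unset_in// sS// mulr1 /spin; ring.
by rewrite unset_notin// addr0.
Qed.

(** Only the ordered pairs containing [u] change, twice its degree in number, and a product of two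
    spins changes by at most 2. *)
Lemma pair_sum_unset_near u s :
  `|\sum_x \sum_(y | e x y) spin R (s x) * spin R (s y)
    - \sum_x \sum_(y | e x y) spin R (unset [set u] s x) * spin R (unset [set u] s y)|
  <= 4 * #|[set y | e u y]%SET|%:R.
Proof.
rewrite -sumrB; under eq_bigr do rewrite -sumrB.
have -> : 4 * #|[set y | e u y]%SET|%:R
   = \sum_x \sum_(y | e x y) (2 * (x == u)%:R + 2 * (y == u)%:R : R).
  have D : #|[set y | e u y]%SET|%:R = \sum_(y | e u y) (1 : R).
    by rewrite -sum1_card natr_sum; under eq_bigl do rewrite inE.
  under eq_bigr do rewrite big_split.
  rewrite big_split /= [X in _ = _ + X](exchange_big_dep xpredT)//=.
  rewrite [X in _ = X + _](bigD1 u)//= [X in _ = _ + X + _]big1 ?addr0; last first.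
    by move=> x xu; rewrite big1// => y _; rewrite (negbTE xu) mulr0.
  rewrite [X in _ = _ + X](bigD1 u)//= [X in _ = _ + (_ + X)]big1 ?addr0; last first.
    by move=> x xu; rewrite big1// => y _; rewrite (negbTE xu) mulr0.
  rewrite (eq_bigl (e u) _ (fun y => e_sym y u)) eqxx D -mulr_sumr; ring.
apply: (le_trans (ler_norm_sum _ _ _)); apply: ler_sum => x _.
apply: (le_trans (ler_norm_sum _ _ _)); apply: ler_sum => y _.
have n2 (b1 b2 b3 b4 : bool) :
    `|spin R b1 * spin R b2 - spin R b3 * spin R b4| <= 2.
  by rewrite ler_norml /spin; case: b1 b2 b3 b4 => -[] [] []; apply/andP; split; lra.
have [xu|xu] := eqVneq x u.
  by apply: (le_trans (n2 _ _ _ _)); rewrite mulr1 lerDl mulr_ge0.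
have [yu|yu] := eqVneq y u.
  by apply: (le_trans (n2 _ _ _ _)); rewrite mulr1 lerDr mulr_ge0.
by rewrite !unset_notin ?inE// subrr normr0 mulr0 addr0.
Qed.

(** Pairs inside [S] keep product 1 and pairs outside are untouched. A boundary pair passes from -1
    to +1, which makes 4 per boundary edge counted in both orders. The number of boundary edges is
    the total degree of [S] minus twice its inner edges: the perimeter. *)
Lemma pair_sum_unset_isolated S s D :
  (forall x, x \in S -> s x) ->
  (forall x y, x \in S -> y \notin S -> e x y -> ~~ s y) ->
  (forall x, #|[set y | e x y]%SET| = D) ->
  \sum_x \sum_(y | e x y) spin R (s x) * spin R (s y)
  = \sum_x \sum_(y | e x y) spin R (unset S s x) * spin R (unset S s y)
    - 4 * (D%:R * #|S|%:R
      - 2 * #|[set A in graph_edges | A \subset S]%SET|%:R).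
Proof.
move=> sS iso hD.
have -> : D%:R * #|S|%:R - 2 * #|[set A in graph_edges | A \subset S]%SET|%:R
   = \sum_(x in S) \sum_(y | e x y) (y \notin S)%:R :> R.
  rewrite card_edges_in mulr_natr -sumr_const -sumrB.
  apply: eq_bigr => x xS; rewrite -(hD x) -!sum1_card !natr_sum.
  under eq_bigl do rewrite inE.
  under [X in _ - X]eq_bigl do rewrite inE andbC.
  rewrite [X in _ - X]big_mkcondr -sumrB; apply: eq_bigr => y _.
  by case: (y \in S); rewrite /= ?subrr ?subr0.
have -> : \sum_(x in S) \sum_(y | e x y) (y \notin S)%:R
   = \sum_x \sum_(y | e x y) ((x \in S) && (y \notin S))%:R :> R.
  rewrite big_mkcond; apply: eq_bigr => x _; case: ifP => xS //=.
  by rewrite big1.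
have -> : 4 * (\sum_x \sum_(y | e x y) ((x \in S) && (y \notin S))%:R)
  = \sum_x \sum_(y | e x y) (2 * ((x \in S) && (y \notin S))%:R
       + 2 * ((y \in S) && (x \notin S))%:R) :> R.
  under [RHS]eq_bigr do rewrite big_split -!mulr_sumr.
  rewrite big_split /= -!mulr_sumr [X in _ = _ + _ * X](exchange_big_dep xpredT)//=.
  under [X in _ = _ + _ * X]eq_bigr => x _.
    rewrite (eq_bigl (e x) _ (fun y => e_sym y x)); over.
  ring.
rewrite -sumrB; apply: eq_bigr => x _; rewrite -sumrB; apply: eq_bigr => y exy.
case: (boolP (x \in S)) => xS; case: (boolP (y \in S)) => yS /=.
- by rewrite !spin_unset_in// !sS//= /spin; ring.
- rewrite spin_unset_in// unset_notin// sS// (negbTE (iso x y xS yS exy)) /spin.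
  ring.
- rewrite (spin_unset_in s yS) unset_notin// (sS y)//.
  by rewrite e_sym in exy; rewrite (negbTE (iso y x yS xS exy)) /spin; ring.
- by rewrite !unset_notin//; ring.
Qed.

Lemma unset1_inj u s t : s u -> t u ->
  unset [set u]%SET s = unset [set u]%SET t -> s = t.
Proof.
move=> su tu /ffunP st; apply/ffunP => x.
have [->|xu] := eqVneq x u; first by rewrite su tu.
by have := st x; rewrite !ffunE inE xu !andbT.
Qed.

(** Sites are peeled off one at a time. [unset [set u]] is injective on configurations positive at
    [u] and keeps the other sites of [S] positive, so each site costs one factor [q]. *)
Lemma sum_all_set_le (w : {ffun T -> bool} -> R) (q : R) S :
  0 <= q -> (forall s, 0 <= w s) ->
  (forall u s, s u -> w s <= q * w (unset [set u] s)) ->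
  \sum_(s : {ffun T -> bool} | [forall x in S, s x]) w s <= q ^+ #|S| * \sum_s w s.
Proof.
move=> q0 w0 wq; move: {2}(#|S|) (erefl #|S|) => k; elim: k S => [|k ih] S Sk.
  rewrite Sk expr0 mul1r [leRHS](bigID (fun s => [forall x in S, s x])) /=.
  by rewrite lerDl sumr_ge0.
have [u uS] : exists u, u \in S by apply/card_gt0P; rewrite Sk.
have Sk' : #|(S :\ u)%SET| = k by move: Sk; rewrite (cardsD1 u) uS => -[].
rewrite Sk exprS -mulrA.
pose full (A : {set T}) : pred {ffun T -> bool} := fun s => [forall x in A, s x].
pose I := [set unset [set u] s | s in full S]%SET.
apply: (@le_trans _ _ (\sum_(s | full (S :\ u)%SET s) q * w s)); last first.
  by rewrite -mulr_sumr ler_wpM2l//; have := ih _ Sk'; rewrite Sk'.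
apply: (@le_trans _ _ (\sum_(s | full S s) q * w (unset [set u] s))).
  by apply: ler_sum => s /forall_inP sS; apply: wq; exact: sS.
have -> : \sum_(s | full S s) q * w (unset [set u] s) = \sum_(t in I) q * w t.
  rewrite big_imset//= => s t /forall_inP sS /forall_inP tS.
  by apply: (@unset1_inj u); [exact: sS|exact: tS].
rewrite [leRHS](bigID (mem I)) /=.
rewrite [leLHS](_ : _ =
    \sum_(t | full (S :\ u)%SET t && (t \in I)) q * w t).
  by rewrite lerDl sumr_ge0// => s _; rewrite mulr_ge0.
apply: eq_bigl => t; apply/idP/andP => [tI|[]//]; split => //.
move/imsetP : tI => [s] /forall_inP sS ->.
apply/forall_inP => x; rewrite !inE => /andP[xu xS].
by rewrite unset_notin ?inE// sS.
Qed.

End finite_graph.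

(** * Geometry of the torus *)

(** The coordinate map inside [recenter], so that [recenterE] holds by definition. *)
Definition residue (n : nat) (w : int) : 'I_n.-1.+1 := inZp `|(w %% n%:Z)%Z|%N.

Section residues.
Variables (n : nat).
Hypothesis n_gt0 : (0 < n)%N.
Implicit Types (w : int) (z : 'I_n.-1.+1).

Lemma ord_eqz z z' : (z : nat)%:Z = (z' : nat)%:Z -> z = z'.
Proof. by case=> h; exact: val_inj. Qed.

Lemma residueE w : (residue n w : nat)%:Z = (w %% n%:Z)%Z.
Proof.
have n0 : n%:Z != 0 by rewrite eqz_nat -lt0n.
rewrite /residue /= prednK// modn_small.
  by rewrite gez0_abs// modz_ge0.
by rewrite -ltz_nat gez0_abs ?modz_ge0// ltz_pmod.
Qed.

Lemma residue_spec w : exists k : int, (residue n w : nat)%:Z = w + k * n%:Z.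
Proof.
exists (- (w %/ n%:Z)%Z); rewrite residueE {2}(divz_eq w n%:Z); ring.
Qed.

Lemma ord_ltn z : (z < n)%N.
Proof. by rewrite -[X in (_ < X)%N](prednK n_gt0). Qed.

Lemma residueD : {morph residue n : u v / u + v}.
Proof.
move=> u v; apply: ord_eqz.
have -> : (residue n u + residue n v : 'I_n.-1.+1)
    = ((residue n u + residue n v)%N %% n)%N :> nat.
  by rewrite -[X in (_ %% X)%N](prednK n_gt0).
by rewrite -modz_nat PoszD !residueE modzDm.
Qed.

Lemma residue0 : residue n 0 = 0.
Proof. by apply: val_inj; rewrite /= mod0z absz0 mod0n. Qed.

Lemma residueN : {morph residue n : u / - u}.
Proof.
by move=> u; apply/eqP; rewrite -subr_eq0 opprK -residueD addNr residue0.
Qed.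

Lemma minresK z : residue n (minres z) = z.
Proof.
apply: ord_eqz.
have zn := ord_ltn z; rewrite residueE /minres.
case: ifP => _; last rewrite -modzDr subrK.
  by rewrite modz_small//; lia.
by rewrite modz_small//; lia.
Qed.

Lemma minres_le z : (`|minres z| * 2 <= n)%N.
Proof.
have zn := ord_ltn z; rewrite /minres; case: ifPn => h; lia.
Qed.

(** The two integers differ by a multiple of n, and a nonzero multiple has absolute value at least
    n. All no-wraparound arguments rest on this dichotomy. *)
Lemma minres_residue_cases w :
  minres (residue n w) = w \/ (n <= `|minres (residue n w)| + `|w|)%N.
Proof.
have [k E] := residue_spec w.
have far (l : int) : l != 0 -> (n <= `|(l * n%:Z)%R|)%N.
  by move=> l0; rewrite abszM absz_nat leq_pmull// absz_gt0.
rewrite /minres; case: ifPn => _; rewrite E.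
  have [->|/far] := eqVneq k 0; [by left; ring|right; lia].
have [k1|/far] := eqVneq (k - 1) 0; last by rewrite mulrBl; right; lia.
by left; rewrite -addrA -{2}[n%:Z]mul1r -mulrBl k1 mul0r addr0.
Qed.

Lemma minres_residue w : (`|w| * 2 < n)%N -> minres (residue n w) = w.
Proof.
move=> wn; have [//|h] := minres_residue_cases w.
have := minres_le (residue n w); lia.
Qed.

Lemma minres_residue_le w : (`|minres (residue n w)| <= `|w|)%N.
Proof.
have [->//|h] := minres_residue_cases w.
have := minres_le (residue n w); lia.
Qed.

Lemma abs_minresD z z' : (`|minres (z + z')%R| <= `|minres z| + `|minres z'|)%N.
Proof.
rewrite -{1}(minresK z) -{1}(minresK z') -residueD.
by apply: (leq_trans (minres_residue_le _)); lia.
Qed.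

Lemma abs_minresN z : `|minres (- z)|%N = `|minres z|%N.
Proof.
have h z' : (`|minres (- z')| <= `|minres z'|)%N.
  rewrite -{1}(minresK z') -residueN.
  by apply: (leq_trans (minres_residue_le _)); rewrite abszN.
apply/eqP; rewrite eqn_leq h /=.
by have := h (- z); rewrite opprK.
Qed.

End residues.

Lemma intr_abs (R : realType) (z : int) : `|z%:~R| = `|z|%N%:R :> R.
Proof. by rewrite -intr_norm. Qed.

(** Summing the i-th coordinates over [V] as integers, the translation adds |V| times the coordinate
    of [t], which must therefore vanish. The factor 6 makes this sum legitimate: [t], a difference
    of two points of [V], has coordinates below n/3, so adding one below n/6 stays below n/2 and
    does not wrap. *)
Lemma translate_rigid d n (n_gt0 : (0 < n)%N) (V : {set torus d n}) (t : torus d n) :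
  (0 < #|V|)%N -> (forall v i, v \in V -> (6 * `|minres (v i)| < n)%N) ->
  [set t + v | v in V]%SET = V -> t = 0.
Proof.
move=> V0 small tV; apply/ffunP => i; rewrite [RHS]ffunE.
have tVin v : v \in V -> t + v \in V by move=> vV; rewrite -tV imset_f.
have /card_gt0P[v0 v0V] := V0.
have tsmall : (3 * `|minres (t i)| < n)%N.
  have -> : t i = (t + v0) i + (- (v0 i)) by rewrite ffunE addrK.
  have := abs_minresD n_gt0 ((t + v0) i) (- (v0 i)); rewrite abs_minresN//.
  have := small _ i v0V; have := small _ i (tVin _ v0V).
  by move: (absz _) (absz _) (absz _) => *; lia.
have minresD v : v \in V -> minres ((t + v) i) = minres (t i) + minres (v i).
  move=> vV; rewrite -[LHS](_ : minres (residue n (minres (t i) + minres (v i))) = _).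
    by rewrite minres_residue//; have := small _ i vV; lia.
  by rewrite residueD// !minresK// ffunE.
have := congr1 (fun W : {set torus d n} => \sum_(v in W) minres (v i)) tV.
rewrite big_imset /=; last by move=> x y _ _; exact: addrI.
rewrite (eq_bigr _ minresD) big_split /= -[RHS]add0r => /addIr.
rewrite sumr_const => /eqP; rewrite mulrn_eq0 eqn0Ngt V0 /= => /eqP t0.
by rewrite -(minresK n_gt0 (t i)) t0 residue0.
Qed.

Section torus_geometry.
Context {R : realType} (p : \bar R) (rho : R) {d : nat}.
Hypotheses (p_ge1 : (1 <= p)%E) (rho_gt0 : 0 < rho).

Lemma lpnorm_abs (u v : 'I_d -> R) :
  (forall i, `|u i| = `|v i|) -> lpnorm p u = lpnorm p v.
Proof.
move=> uv; rewrite /lpnorm; case: (p) => [q||]; last by [].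
  by congr (_ `^ _); apply: eq_bigr => i _; rewrite uv.
by apply: eq_bigr => i _; rewrite uv.
Qed.

Lemma lpnorm_ge (u : 'I_d -> R) i : `|u i| <= lpnorm p u.
Proof.
rewrite /lpnorm; move: p_ge1; case: (p) => [q||]; [|move=> _; exact: le_bigmax|by []].
rewrite lee_fin => q1; have q0 : 0 < q by apply: lt_le_trans q1.
rewrite -[leLHS](@powRr1 _ `|u i|)// -[X in _ `^ X](@mulfV _ q) ?gt_eqF//.
rewrite powRrM ge0_ler_powR ?nnegrE ?invr_ge0 ?powR_ge0 ?(ltW q0)//.
  by apply: sumr_ge0 => j _; exact: powR_ge0.
by rewrite (bigD1 i)//= lerDl sumr_ge0// => j _; exact: powR_ge0.
Qed.

Section one_torus.
Variable n : nat.
Hypothesis n_gt0 : (0 < n)%N.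
Implicit Types x y z : torus d n.

Lemma adjE x y : adj p rho x y = adj p rho 0 (y - x).
Proof. by rewrite /adj subr0 [in RHS]eq_sym subr_eq0 eq_sym. Qed.

Lemma adj_irr : irreflexive (@adj R p rho d n).
Proof. by move=> x; rewrite /adj eqxx. Qed.

Lemma adj_sym : symmetric (@adj R p rho d n).
Proof.
move=> x y; rewrite /adj eq_sym; congr (_ && (_ <= _)).
apply: lpnorm_abs => i; rewrite !intr_abs; congr (_%:R).
by rewrite -opprB ffunE abs_minresN.
Qed.

Lemma degreeE x : degree p rho x = degree p rho (0 : torus d n).
Proof.
rewrite /degree -[RHS](card_imset _ (addrI x)); congr #|pred_of_set _|.
apply/setP => y; rewrite inE adjE; apply/idP/imsetP.
  by exists (y - x); rewrite ?inE// addrC subrK.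
by move=> [z]; rewrite inE => h ->; rewrite addrC addKr.
Qed.

Lemma adj_minres x y i : adj p rho x y -> `|minres ((y - x)%R i)|%N%:R <= rho.
Proof.
by move=> /andP[_]; apply: le_trans; rewrite -intr_abs; exact: lpnorm_ge.
Qed.

Lemma gball_minres r y i :
  y \in gball p rho 0 r -> `|minres (y i)|%N%:R <= r%:R * rho.
Proof.
rewrite inE => yr.
have pathP s x : path (adj p rho) x s ->
    `|minres ((last x s - x)%R i)|%N%:R <= (size s)%:R * rho.
  elim: s x => [|z s ih] x /=.
    by rewrite subrr ffunE mul0r.
  move=> /andP[xz /ih h].
  rewrite (_ : last z s - x = (last z s - z) + (z - x)); last by rewrite addrA subrK.
  rewrite ffunE; apply: (@le_trans _ _
    (`|minres ((last z s - z)%R i)| + `|minres ((z - x)%R i)|)%N%:R).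
    by rewrite ler_nat; exact: abs_minresD.
  by rewrite natrD -natr1 mulrDl mul1r lerD// adj_minres.
(* An infimum below r + 1 provides a path of length less than r + 1, hence at most r. *)
have : (gdist p rho (0 : torus d n)%R y < r.+1%:R%:E)%E.
  by apply: le_lt_trans yr _; rewrite lte_fin ltr_nat.
move=> /ereal_inf_lt[_ [s [ps <-{y yr}] <-]]; rewrite lte_fin ltr_nat ltnS => sr.
by have := pathP s 0 ps; rewrite subr0 => /le_trans; apply; rewrite ler_pM2r// ler_nat.
Qed.


(* A difference that wraps around is too long for an edge before and after the
   reduction modulo n: this is where n > 2 rho (r + 1) comes from. *)
Lemma adj_residue r (u v : 'I_d -> int) :
  (0 < r)%N -> 2 * rho * (r%:R + 1) < n%:R ->
  (forall i, `|u i|%N%:R <= r%:R * rho) -> (forall i, `|v i|%N%:R <= r%:R * rho) ->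
  adj p rho ([ffun i => residue n (u i)] : torus d n) [ffun i => residue n (v i)]
  = [exists i, u i != v i] && (lpnorm p (fun i => (v i - u i)%:~R) <= rho).
Proof.
move=> r0 rn hu hv; rewrite /adj.
have r1 : 1 <= r%:R :> R by rewrite ler1n.
have {}rn : 2 * (r%:R * rho) + 2 * rho < n%:R.
  by move: rn; rewrite mulrDr mulr1 -mulrA [rho * _]mulrC.
have small (w : int) : `|w|%N%:R <= r%:R * rho -> (`|w| * 2 < n)%N.
  by move=> hw; rewrite -(ltr_nat R) natrM; have := rho_gt0; lra.
congr andb.
  apply/idP/existsP => [uv|[i uv]].
    apply/existsP; apply: contraR uv => /existsPn uv; apply/eqP/ffunP => i.
    by rewrite !ffunE; have /negPn/eqP-> := uv i.
  apply: contraNneq uv => /ffunP /(_ i); rewrite !ffunE => uv.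
  by rewrite -(minres_residue n_gt0 (small _ (hu i))) uv minres_residue// small.
under [in LHS]eq_fun => i do rewrite !ffunE -residueN// -residueD//.
have [h|] := pselect (forall i, minres (residue n (v i - u i)) = v i - u i).
  by under [in LHS]eq_fun do rewrite h.
move/existsNP => [i hi].
have [//|wrap] := minres_residue_cases n_gt0 (v i - u i).
have b1 := minres_le n_gt0 (residue n (v i - u i)).
set m := `|minres _|%N in wrap b1.
have b2 : (`|v i - u i| <= `|v i| + `|u i|)%N by lia.
have b1R : m%:R * 2 <= n%:R :> R by rewrite -natrM ler_nat.
have wrapR : n%:R <= m%:R + `|v i - u i|%N%:R :> R by rewrite -natrD ler_nat.
have b2R : `|v i - u i|%N%:R <= `|v i|%N%:R + `|u i|%N%:R :> R by rewrite -natrD ler_nat.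
have hui := hu i; have hvi := hv i.
(* When coordinate [i] wraps, [m] is at least n - 2 r rho and the unreduced difference at least n/2.
   Both exceed rho, so both norm conditions fail. *)
have far (f : 'I_d -> int) : rho < `|f i|%N%:R ->
    (lpnorm p (fun i => (f i)%:~R) <= rho) = false.
  move=> fi; apply/negbTE; rewrite -ltNge (lt_le_trans fi)//.
  by rewrite -intr_abs; exact: (lpnorm_ge (fun i => (f i)%:~R)).
by rewrite !far//; rewrite -?/m; have := rho_gt0; lra.
Qed.

End one_torus.

(** * Transport of the graph between tori of different sizes *)

Section two_tori.
Variables n0 n : nat.
Hypotheses (n0_gt0 : (0 < n0)%N) (n_gt0 : (0 < n)%N).

Lemma recenterE (y : torus d n0) : recenter n y = [ffun i => residue n (minres (y i))].
Proof. by []. Qed.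

Lemma minres_recenter (y : torus d n0) i :
  (`|minres (y i)| * 2 < n)%N -> minres (recenter n y i) = minres (y i).
Proof. by move=> h; rewrite ffunE minres_residue. Qed.

Lemma recenterK (y : torus d n0) :
  (forall i, `|minres (y i)| * 2 < n)%N -> recenter n0 (recenter n y) = y.
Proof.
by move=> h; apply/ffunP => i; rewrite ffunE minres_recenter// -[RHS]minresK.
Qed.

Lemma adj_recenter r (x y : torus d n0) : (0 < r)%N ->
  2 * rho * (r%:R + 1) < n0%:R -> 2 * rho * (r%:R + 1) < n%:R ->
  x \in gball p rho 0 r -> y \in gball p rho 0 r ->
  adj p rho (recenter n x) (recenter n y) = adj p rho x y.
Proof.
move=> r0 hn0 hn xr yr.
have E (z : torus d n0) : z = [ffun i => residue n0 (minres (z i))].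
  by apply/ffunP => i; rewrite ffunE minresK.
rewrite [in RHS](E x) [in RHS](E y) !recenterE.
by rewrite !(@adj_residue _ _ r)// => i; exact: gball_minres.
Qed.

(** [recenter] embeds the neighbours of 0 in one torus into those in the other, with the opposite
    [recenter] as left inverse. Exchanging the two sizes then gives equality. *)
Lemma degree_recenter_le : 2 * rho < n0%:R -> 2 * rho < n%:R ->
  (degree p rho (0%R : torus d n0) <= degree p rho (0%R : torus d n))%N.
Proof.
move=> hn0 hn.
have small (y : torus d n0) i : adj p rho 0 y -> (`|minres (y i)| * 2 < n)%N.
  move=> /(@adj_minres _ (0 : torus d n0) y i); rewrite subr0 => h.
  by rewrite -(ltr_nat R) natrM; lra.
rewrite /degree -(@card_in_imset _ _ (recenter n)); last first.
  move=> x y; rewrite !inE => ax ay.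
  by move=> /(congr1 (recenter n0)); rewrite !recenterK// => i; exact: small.
apply/subset_leq_card/fintype.subsetP => z /imsetP[y]; rewrite inE => ay ->{z}.
rewrite inE /adj subr0.
move: (ay) => /andP[y0 hy]; apply/andP; split.
  apply: contra_neq y0 => h; rewrite -(recenterK (fun i => small y i ay)) -h.
  by apply/ffunP => i; rewrite !ffunE; exact/esym/residue0.
apply: le_trans hy; rewrite subr0 (@lpnorm_abs _ (fun i => (minres (y i))%:~R))// => i.
by rewrite minres_recenter// small.
Qed.

End two_tori.

Lemma degree_recenter n0 n : (0 < n0)%N -> (0 < n)%N ->
  2 * rho < n0%:R -> 2 * rho < n%:R ->
  degree p rho (0 : torus d n) = degree p rho (0 : torus d n0).
Proof.
move=> *; by apply/eqP; rewrite eqn_leq !degree_recenter_le.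
Qed.

End torus_geometry.
(** * Counting copies by erasing them *)

Section counting.
Variables (R : realType) (G : finZmodType) (B V N : {set G}).
Hypotheses (V_neq0 : V != finset.set0) (VB : V \subset B)
  (BN : forall b1 b2 b3, b1 \in B -> b2 \in B -> b3 \in B -> b1 - b2 + b3 \in N)
  (V_rigid : forall t, [set t + v | v in V]%SET = V -> t = 0).
Implicit Types (x y z : G) (s : {ffun G -> bool}).

(** In a finite abelian group, [B] stands for the ball, [V] for its positive sites and [N] for the
    window. Encoding the pattern by [V] lets one set prescribe the spins both on [B] ([occ]) and,
    with negative surroundings, on [N] ([clean]). *)
Definition occ x s := [forall z in B, s (x + z) == (z \in V)].
Definition count_occ s : nat := \sum_x occ x s.
Definition clean x s := [forall z in N, s (x + z) == (z \in V)].
Definition vacant x s := [forall z in N, ~~ s (x + z)].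

Local Notation shift x := [set x + v | v in V]%SET.

Let VBP z : z \in V -> z \in B.
Proof. by move/fintype.subsetP : VB; exact. Qed.

Let BNP z : z \in B -> z \in N.
Proof. by move=> zB; rewrite -[z](@subrK _ z) BN. Qed.

Lemma in_shift x z : (z \in shift x) = (z - x \in V).
Proof.
apply/imsetP/idP => [[v vV ->]|zV]; first by rewrite addrC addKr.
by exists (z - x) => //; rewrite addrC subrK.
Qed.

Lemma clean_occ x s : clean x s -> occ x s.
Proof.
move=> /forall_inP h; apply/forall_inP => z zB; exact/h/BNP.
Qed.

Lemma occ_shift x s z : occ x s -> z \in shift x -> s z.
Proof.
move=> /forall_inP h; rewrite in_shift => zV.
by have := h _ (VBP zV); rewrite zV addrC subrK => /eqP.
Qed.

(* Two copies of V inside the clean window would be distinct translates of V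
   filled by the same |V| positive sites. *)
Lemma count_occ_unset x s : clean x s ->
  count_occ s = (count_occ (unset (shift x) s)).+1.
Proof.
move=> cx; have /forall_inP cxP := cx.
(* After the erasure the whole window around [x] is negative. *)
have winS y z : y + z - x \in N -> unset (shift x) s (y + z) = false.
  move=> h; rewrite ffunE in_shift.
  by have := cxP _ h; rewrite addrC subrK => /eqP->; rewrite andbN.
have [v0 v0V] : exists v, v \in V by apply/finset.set0Pn.
rewrite /count_occ (bigD1 x)//= [in RHS](bigD1 x)//= clean_occ//.
have -> : occ x (unset (shift x) s) = false.
  apply/negbTE/negP => h.
  have := winS x v0; rewrite (occ_shift h) ?in_shift [x + v0]addrC addrK//.
  by move=> /(_ (BNP (VBP v0V))).
rewrite add1n add0n; congr S; apply: eq_bigr => y yx; congr nat_of_bool.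
(* Either [y + B] misses the erased sites and the erasure is invisible to a copy at [y], or [y + B]
   lies in the window by [BN]. *)
have [/existsP[b /andP[bB ybV]]|/existsPn far] :=
    boolP [exists b, (b \in B) && (y + b \in shift x)]; last first.
  rewrite /occ; apply: eq_forallb_in => b bB; rewrite ffunE.
  by have := far b; rewrite bB /= => ->; rewrite andbT.
have inN z : z \in B -> y + z - x \in N.
  move=> zB; rewrite in_shift in ybV.
  have -> : y + z - x = (y + b - x) - b + z.
    by rewrite [y + b - x]addrAC addrK addrAC.
  by apply: BN => //; exact: VBP.
transitivity false; last first.
  apply/esym/negbTE/negP => h.
  have := winS y v0 (inN _ (VBP v0V)).
  by rewrite (occ_shift h)// in_shift [y + v0]addrC addrK.
apply/negbTE/negP => oy; move/eqP : yx; apply.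
have sub : shift y \subset shift x.
  apply/fintype.subsetP => z zy; rewrite in_shift.
  have zyV : z - y \in V by rewrite -in_shift.
  have zN : z - x \in N by have := inN _ (VBP zyV); rewrite [y + _]addrC subrK.
  have /eqP <- := cxP _ zN.
  by rewrite [x + _]addrC subrK (occ_shift oy).
have : shift y = shift x.
  apply/eqP; rewrite eqEcard sub /= !card_imset//; exact: addrI.
move=> E; apply/eqP; rewrite -subr_eq0; apply/eqP/V_rigid/setP => z.
rewrite (in_shift (y - x) z) opprB addrA.
have : (z + x \in shift y) = (z + x \in shift x) by rewrite E.
by rewrite !in_shift addrK.
Qed.

(** * Weighted counts: recursion, mean and tail *)

Section weights.
Variables (w : {ffun G -> bool} -> R) (q th : R).
Hypotheses (w_ge0 : forall s, 0 <= w s) (q_ge0 : 0 <= q) (th_ge0 : 0 <= th)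
  (w_pos : forall S : {set G},
     \sum_(s : {ffun G -> bool} | [forall x in S, s x]) w s <= q ^+ #|S| * \sum_s w s)
  (w_clean : forall x s, clean x s -> w s = th * w (unset (shift x) s)).

Local Notation Z := (\sum_s w s).

Let ler_sum_sub (P Q : pred {ffun G -> bool}) : (forall s, P s -> Q s) ->
  \sum_(s | P s) w s <= \sum_(s | Q s) w s.
Proof.
move=> PQ; rewrite [leRHS](bigID P) /=.
rewrite (eq_bigl P); first by rewrite lerDl sumr_ge0.
by move=> s; case: (boolP (P s)) => [/PQ ->|]; rewrite ?andbF.
Qed.

Let union_bound (P : pred {ffun G -> bool}) (A : {set G})
    (Q : G -> pred {ffun G -> bool}) (c : R) :
  (forall s, P s -> exists2 z, z \in A & Q z s) ->
  (forall z, z \in A -> \sum_(s | Q z s) w s <= c) ->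
  \sum_(s | P s) w s <= #|A|%:R * c.
Proof.
move=> PQ Qc; rewrite mulr_natl -sumr_const.
apply: (@le_trans _ _ (\sum_(z in A) \sum_(s | Q z s) w s)); last exact: ler_sum.
rewrite (exchange_big_dep xpredT)//= big_mkcond; apply: ler_sum => s _.
case: ifP => [/PQ[z zA Qz]|_]; last exact: sumr_ge0.
by rewrite (bigD1 z)/= ?zA// lerDl sumr_ge0.
Qed.

(** Erasing is a bijection from the clean configurations with j + 1 copies onto the vacant ones with
    j, inverted by [fill]; the identity carries no error. *)
Lemma sum_clean x j :
  \sum_(s | clean x s && (count_occ s == j.+1)) w s
    = th * \sum_(s | vacant x s && (count_occ s == j)) w s.
Proof.
pose fill s : {ffun G -> bool} := [ffun y => s y || (y \in shift x)].
have fillK s : vacant x s -> unset (shift x) (fill s) = s.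
  move=> /forall_inP h; apply/ffunP => y; rewrite !ffunE in_shift.
  case: (boolP (y - x \in V)) => yV; rewrite ?andbT ?orbF// andbF.
  by have := h _ (BNP (VBP yV)); rewrite [x + _]addrC subrK => /negbTE.
have unsetK s : clean x s -> fill (unset (shift x) s) = s.
  move=> /forall_inP h; apply/ffunP => y; rewrite !ffunE in_shift.
  case: (boolP (y - x \in V)) => yV; rewrite ?andbT ?orbF// orbT.
  by have := h _ (BNP (VBP yV)); rewrite [x + _]addrC subrK yV => /eqP.
have fill_clean s : vacant x s -> clean x (fill s).
  move=> /forall_inP h; apply/forall_inP => z zN; rewrite ffunE in_shift.
  by rewrite (negbTE (h _ zN)) /= [x + z]addrC addrK.
rewrite (reindex_onto fill (unset (shift x))) /=; last first.
  by move=> s /andP[cs _]; exact: unsetK.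
rewrite mulr_sumr; apply: eq_big => s.
  apply/andP/andP => [[/andP[cs Xs] /eqP fs]|[vs Xs]].
    have vs : vacant x s.
      apply/forall_inP => z zN; rewrite -fs ffunE in_shift.
      by move/forall_inP : cs => /(_ _ zN) /eqP ->; rewrite [x + z]addrC addrK andbN.
    by split => //; rewrite (count_occ_unset cs) fillK// eqSS in Xs.
  have cs := fill_clean _ vs; rewrite cs fillK// eqxx; split => //.
  by rewrite (count_occ_unset cs) fillK// eqSS.
by move=> /andP[/andP[cs _] /eqP fs]; rewrite (w_clean cs) fs.
Qed.

(** A copy that is not clean has a positive site of the window off [V] besides its own |V| ones. The
    additional factor [q] makes the sum over all positions negligible. *)
Lemma sum_dirty x j :
  \sum_(s | [&& occ x s, ~~ clean x s & count_occ s == j]) w s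
    <= #|N|%:R * (q ^+ #|V|.+1 * Z).
Proof.
apply: le_trans (_ : #|N :\: V|%:R * (q ^+ #|V|.+1 * Z) <= _); last first.
  rewrite ler_wpM2r ?mulr_ge0 ?exprn_ge0 ?sumr_ge0//.
  by rewrite ler_nat subset_leq_card// finset.subsetDl.
apply: (@union_bound _ _
    (fun z s => [forall y in ((x + z) |: shift x)%SET, s y])) => [s|z].
  move=> /and3P[ox /forall_inPn[z zN nz] _].
  have zV : z \notin V.
    apply: contraNN nz => zV; rewrite zV (occ_shift ox)//.
    by rewrite in_shift addrC addKr.
  exists z; first by rewrite inE zV zN.
  apply/forall_inP => y; rewrite !inE => /orP[/eqP->|/(occ_shift ox)//].
  by move: nz; rewrite (negbTE zV); case: (s _).
rewrite inE => /andP[zV _].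
by rewrite (le_trans (w_pos _))// cardsU1 in_shift addrC addKr zV card_imset//; exact: addrI.
Qed.

Lemma sum_not_vacant x j :
  \sum_(s | ~~ vacant x s && (count_occ s == j)) w s <= #|N|%:R * (q * Z).
Proof.
apply: (@union_bound _ _ (fun z s => [forall y in [set x + z]%SET, s y])) => [s|z _].
  move=> /andP[/forall_inPn[z zN nz] _]; exists z => //.
  by apply/forall_inP => y; rewrite inE => /eqP ->; rewrite -[s _]negbK.
by rewrite (le_trans (w_pos _))// cards1 expr1.
Qed.

Lemma count_recursion j :
  `|j.+1%:R * \sum_(s | count_occ s == j.+1) w s
     - #|G|%:R * th * \sum_(s | count_occ s == j) w s|
  <= #|G|%:R * #|N|%:R * (q ^+ #|V|.+1 + th * q) * Z.
Proof.
(* Multiplying by j + 1 marks one of the j + 1 copies, so the sum can be taken over positions. *)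
have -> : j.+1%:R * \sum_(s | count_occ s == j.+1) w s
    = \sum_x \sum_(s | occ x s && (count_occ s == j.+1)) w s.
  rewrite (exchange_big_dep (fun s => count_occ s == j.+1))/=; last first.
    by move=> x s _ /andP[].
  rewrite mulr_sumr; apply: eq_bigr => s /eqP Xs.
  rewrite -Xs mulr_natl [RHS]big_mkcond {1}/count_occ -sumrMnr /=.
  by apply: eq_bigr => x _; rewrite eqxx andbT; case: occ.
have -> : #|G|%:R * th * \sum_(s | count_occ s == j) w s
    = \sum_(x : G) th * \sum_(s | count_occ s == j) w s.
  by rewrite sumr_const cardT -mulrA mulr_natl -cardT.
rewrite -sumrB; apply: (le_trans (ler_norm_sum _ _ _)).
have -> : #|G|%:R * #|N|%:R * (q ^+ #|V|.+1 + th * q) * Z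
    = \sum_(x : G) #|N|%:R * (q ^+ #|V|.+1 + th * q) * Z.
  by rewrite sumr_const -!mulrA mulr_natl.
apply: ler_sum => x _.
rewrite (bigID (clean x)) /= [X in _ - _ * X](bigID (vacant x)) /=.
have E1 : \sum_(s | (occ x s && (count_occ s == j.+1)) && clean x s) w s
    = \sum_(s | clean x s && (count_occ s == j.+1)) w s.
  apply: eq_bigl => s; case: (boolP (clean x s)) => [cs|]; last by rewrite andbF.
  by rewrite (clean_occ cs) andbT.
have E2 : \sum_(s | (count_occ s == j) && vacant x s) w s
    = \sum_(s | vacant x s && (count_occ s == j)) w s.
  by apply: eq_bigl => s; rewrite andbC.
(* The clean and vacant parts cancel exactly; only the dirty and nonvacant remainders are
   estimated. *)
rewrite E1 E2 sum_clean mulrDr opprD addrACA subrr add0r.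
have h1 := sum_dirty x j.+1; have h2 := sum_not_vacant x j.
rewrite (eq_bigl (fun s => [&& occ x s, ~~ clean x s & count_occ s == j.+1])); last first.
  by move=> s; rewrite -andbA [(count_occ s == _) && _]andbC.
rewrite [X in _ - _ * X](eq_bigl (fun s => ~~ vacant x s && (count_occ s == j))); last first.
  by move=> s; rewrite andbC.
apply: (le_trans (ler_normB _ _)); rewrite !ger0_norm ?mulr_ge0 ?sumr_ge0//.
have -> : #|N|%:R * (q ^+ #|V|.+1 + th * q) * Z
   = #|N|%:R * (q ^+ #|V|.+1 * Z) + th * (#|N|%:R * (q * Z)) by ring.
by rewrite lerD// ler_wpM2l.
Qed.

Lemma count_mean : \sum_s (count_occ s)%:R * w s <= #|G|%:R * q ^+ #|V| * Z.
Proof.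
have -> : \sum_s (count_occ s)%:R * w s = \sum_x \sum_(s | occ x s) w s.
  rewrite (exchange_big_dep xpredT)//=; apply: eq_bigr => s _.
  rewrite mulr_natl [RHS]big_mkcond {1}/count_occ -sumrMnr /=.
  by apply: eq_bigr => x _; case: occ.
rewrite -mulrA mulr_natl -sumr_const; apply: ler_sum => x _.
apply: (@le_trans _ _ (\sum_(s : {ffun G -> bool} | [forall y in shift x, s y]) w s)).
  by apply: ler_sum_sub => s os; apply/forall_inP => y; exact: occ_shift.
by rewrite (le_trans (w_pos _))// card_imset//; exact: addrI.
Qed.

(** Markov's inequality for the count plus one, so that the denominator stays positive at J = 0. *)
Lemma count_tail J :
  Z - \sum_(j < J) \sum_(s | count_occ s == j :> nat) w s
    <= (1 + #|G|%:R * q ^+ #|V|) * Z / J.+1%:R.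
Proof.
have -> : \sum_(j < J) \sum_(s | count_occ s == j :> nat) w s
    = \sum_(s | (count_occ s < J)%N) w s.
  elim: J => [|J ih].
    by rewrite big_ord0 big1.
  rewrite big_ord_recr ih /= [RHS](bigID (fun s => count_occ s == J)) /= addrC.
  congr (_ + _); apply: eq_bigl => s.
    by rewrite ltnS; case: eqP => [->|]; rewrite ?leqnn ?andbF.
  by rewrite ltnS ltn_neqAle andbC.
rewrite [X in X - _](bigID (fun s => (count_occ s < J)%N)) /= addrAC subrr add0r.
rewrite ler_pdivlMr// mulrC mulr_sumr mulrDl mul1r.
apply: le_trans (lerD (lexx _) count_mean).
rewrite -big_split /= big_mkcond; apply: ler_sum => s _.
rewrite -{2}[w s]mul1r -mulrDl; case: ifPn => [|_].
  by rewrite -leqNgt => h; rewrite ler_wpM2r// nat1r ler_nat.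
by rewrite mulr_ge0// nat1r.
Qed.

End weights.
End counting.

(** * Copies of a local configuration in the torus *)

(** Joins the finite and the group structure, so that the torus can serve as the group [G] of the
    counting. *)
HB.instance Definition _ (aT : finType) (rT : finZmodType) :=
  Finite.on {ffun aT -> rT}.

Section ising_weights.
Context {R : realType} (p : \bar R) (rho : R) (d n : nat) (a b : R).
Hypothesis n_gt0 : (0 < n)%N.
Implicit Types (s : {ffun torus d n -> bool}).

Local Notation w := (ising_weight p rho a b).
Local Notation adj := (@adj R p rho d n).
Local Notation D := (degree p rho (0 : torus d n)).

Let card_adj x : #|[set y | adj x y]%SET| = D.
Proof. exact: degreeE. Qed.

Lemma ising_weightE s : w s = expR (a * (\sum_x spin R (s x))
  + b / 2 * (\sum_x \sum_(y | adj x y) spin R (s x) * spin R (s y))).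
Proof.
rewrite /ising_weight /edges; congr (expR (_ + _)).
rewrite -(sum_edges_spin _ (@adj_irr _ _ _ _ _) (adj_sym p rho n_gt0)).
by rewrite mulrA divfK.
Qed.

Lemma ising_weight_unset1 u s : s u ->
  w s <= expR (2 * a) * expR (2 * `|b| * D%:R) * w (unset [set u]%SET s).
Proof.
move=> su; rewrite !ising_weightE -!expRD ler_expR.
rewrite (@sum_spin_unset R _ [set u]%SET s); last by move=> x; rewrite inE => /eqP->.
have := @pair_sum_unset_near R _ adj (adj_sym p rho n_gt0) u s.
rewrite card_adj cards1.
set P := \sum_x \sum_(y | _) _; set P' := \sum_x \sum_(y | _) _ => h.
(* The energy carries [b / 2] because ordered pairs count each edge twice; this turns the bound 4 D
   into 2 |b| D. *)
have : b / 2 * (P - P') <= `|b| / 2 * (4 * D%:R).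
  apply: le_trans (ler_norm _) _; rewrite !normrM [`|2^-1|]ger0_norm ?invr_ge0//.
  by rewrite ler_wpM2l ?mulr_ge0 ?invr_ge0.
set T := \sum_x spin R _; move=> {h}.
have -> : b / 2 * (P - P') = b / 2 * P - b / 2 * P' by ring.
have -> : `|b| / 2 * (4 * D%:R) = 2 * `|b| * D%:R by field.
have -> : a * (T + 2 * 1) = a * T + 2 * a by ring.
lra.
Qed.

Lemma ising_weight_unset (S : {set torus d n}) s :
  (forall x, x \in S -> s x) ->
  (forall x y, x \in S -> y \notin S -> adj x y -> ~~ s y) ->
  w s = expR (2 * a) ^+ #|S| * expR (- 2 * b * (D%:R * #|S|%:R
      - 2 * #|[set A in edges p rho | A \subset S]%SET|%:R)) * w (unset S s).
Proof.
move=> sS iso; rewrite !ising_weightE -expRM_natl -!expRD; congr expR.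
rewrite (sum_spin_unset R sS).
rewrite (pair_sum_unset_isolated R (@adj_irr _ _ _ _ _) (adj_sym p rho n_gt0)
  sS iso card_adj).
by rewrite /edges; field.
Qed.

Lemma ising_Z_gt0 : 0 < ising_Z p rho d n a b.
Proof.
rewrite /ising_Z (bigD1 [ffun=> false]) //= ltr_pwDl ?expR_gt0 //.
by apply: sumr_ge0 => s _; exact: expR_ge0.
Qed.

End ising_weights.

Section pattern.
Context {R : realType} (p : \bar R) (rho : R) (d n0 r : nat)
  (eta : local_config p rho d n0 r).
Hypotheses (p_ge1 : (1 <= p)%E) (rho_gt0 : 0 < rho) (r_gt0 : (0 < r)%N)
  (n0_large : 2 * rho * (r%:R + 1) < n0%:R) (k_gt0 : (0 < kplus eta)%N).

Local Notation k := (kplus eta).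
Local Notation D0 := (degree p rho (0 : torus d n0)).

Lemma mem_vplus (y : {y : torus d n0 | y \in gball p rho 0 r}) :
  (val y \in vplus eta) = eta y.
Proof.
apply/imsetP/idP => [[z]|ey]; last by exists y; rewrite ?inE.
by rewrite inE => ez /val_inj ->.
Qed.

Lemma vplus_gball : vplus eta \subset gball p rho 0 r.
Proof. by apply/fintype.subsetP => _ /imsetP[y _ ->]; exact: valP. Qed.

Let n0_gt0 : (0 < n0)%N.
Proof.
rewrite -(ltr_nat R) (le_lt_trans _ n0_large)//.
by rewrite mulr_ge0 ?addr_ge0// mulr_ge0// ltW.
Qed.

Section size.
Variable n : nat.
Hypotheses (n_large : 2 * rho * (r%:R + 1) < n%:R)
  (n_large' : 6 * (r%:R * rho) < n%:R).

Let n_gt0 : (0 < n)%N.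
Proof.
rewrite -(ltr_nat R) (le_lt_trans _ n_large)//.
by rewrite mulr_ge0 ?addr_ge0// mulr_ge0// ltW.
Qed.

Definition ballset : {set torus d n} :=
  [set recenter n y | y in gball p rho (0 : torus d n0) r]%SET.
Definition posset : {set torus d n} := [set recenter n y | y in vplus eta]%SET.
(* Large enough to contain every translate of the ball that meets the ball
   itself, and all neighbours of the positive sites. *)
Definition window : {set torus d n} :=
  ([set t.1.1 - t.1.2 + t.2 |
     t in finset.setX (finset.setX ballset ballset) ballset]
   :|: [set t.1 + t.2 |
     t in finset.setX posset [set z | adj p rho (0 : torus d n) z]])%SET.

Let gball_small (y : torus d n0) i : y \in gball p rho 0 r ->
  (6 * `|minres (y i)| < n)%N.
Proof.
move=> /(@gball_minres _ _ _ _ p_ge1 rho_gt0 _ n0_gt0 _ _ i) h.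
by rewrite -(ltr_nat R) natrM (le_lt_trans _ n_large')// ler_pM2l.
Qed.

Let gball_small2 (y : torus d n0) i : y \in gball p rho 0 r ->
  (`|minres (y i)| * 2 < n)%N.
Proof. by move=> /(gball_small i); move: (absz _) => m; lia. Qed.

Let recenter_inj : {in gball p rho (0 : torus d n0) r &, injective (@recenter d n0 n)}.
Proof.
move=> x y xr yr /(congr1 (recenter n0)).
by rewrite !recenterK// => i; exact: gball_small2.
Qed.

Let vplusP y : y \in vplus eta -> y \in gball p rho 0 r.
Proof. by move/fintype.subsetP : vplus_gball; exact. Qed.

Let recenter_inj_vplus : {in vplus eta &, injective (@recenter d n0 n)}.
Proof. by move=> x y /vplusP xr /vplusP yr; exact: recenter_inj. Qed.

Lemma mem_posset y : y \in gball p rho 0 r ->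
  (recenter n y \in posset) = (y \in vplus eta).
Proof.
move=> yr; apply/imsetP/idP => [[z zv]|yv]; last by exists y.
by move/recenter_inj => -> //; exact: vplusP.
Qed.

Lemma posset_ballset : posset \subset ballset.
Proof. by apply: imsetS; exact: vplus_gball. Qed.

Lemma card_posset : #|posset| = k.
Proof. exact: card_in_imset. Qed.

Lemma occursE x s : occurs eta x s = occ ballset posset x s.
Proof.
apply/forallP/forall_inP => [h z /imsetP[y yr ->]|h y].
  have := h (exist _ y yr); rewrite /= => /eqP->.
  by rewrite mem_posset// -mem_vplus.
have := h (recenter n (val y)) (imset_f _ (valP y)).
by rewrite mem_posset ?mem_vplus//; exact: valP.
Qed.

Lemma copiesE s : copies eta n s = (count_occ ballset posset s)%:R.
Proof.
rewrite /copies /count_occ natr_sum; apply: eq_bigr => x _.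
by rewrite occursE.
Qed.

Lemma degree_size : degree p rho (0 : torus d n) = D0.
Proof.
have r1 : 2 * rho <= 2 * rho * (r%:R + 1).
  by rewrite ler_peMr ?lerDr// mulr_ge0// ltW.
by apply: degree_recenter => //; exact: le_lt_trans r1 _.
Qed.

Lemma card_edges_posset :
  2 * #|[set A in edges p rho | A \subset posset]%SET|%:R
  = 2 * #|[set A in edges p rho | A \subset vplus eta]%SET|%:R :> R.
Proof.
rewrite /edges !card_edges_in; last first.
- exact: adj_sym.
- exact: adj_irr.
- exact: adj_sym.
- exact: adj_irr.
rewrite big_imset//=; apply: eq_bigr => x xV; congr (_%:R).
rewrite -[RHS](@card_in_imset _ _ (recenter n)); last first.
  by move=> u v; rewrite !inE => /andP[uV _] /andP[vV _]; exact: recenter_inj_vplus.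
congr #|pred_of_set _|; apply/setP => z; rewrite inE; apply/andP/imsetP.
  move=> [/imsetP[y yV ->]].
  rewrite (@adj_recenter _ _ _ _ p_ge1 rho_gt0 _ _ _ _ r)//; [|exact: vplusP..].
  by move=> xy; exists y => //; rewrite inE yV.
move=> [y]; rewrite inE => /andP[yV xy] ->; rewrite imset_f//.
by rewrite (@adj_recenter _ _ _ _ p_ge1 rho_gt0 _ _ _ _ r)//; exact: vplusP.
Qed.

Lemma perimeter_size : (perimeter eta)%:~R
  = (degree p rho (0 : torus d n))%:R * #|posset|%:R
   - 2 * #|[set A in edges p rho | A \subset posset]%SET|%:R :> R.
Proof.
by rewrite degree_size card_posset card_edges_posset /perimeter rmorphB !rmorphM.
Qed.

Lemma posset_rigid t : [set t + v | v in posset]%SET = posset -> t = 0.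
Proof.
apply: translate_rigid => //; first by rewrite card_posset.
move=> _ i /imsetP[y /vplusP yr ->].
by rewrite minres_recenter ?gball_small2// gball_small.
Qed.

Lemma window_ballset b1 b2 b3 : b1 \in ballset -> b2 \in ballset ->
  b3 \in ballset -> b1 - b2 + b3 \in window.
Proof.
move=> h1 h2 h3; rewrite inE; apply/orP; left; apply/imsetP.
by exists (b1, b2, b3) => //; rewrite !inE h1 h2 h3.
Qed.

(** The bound does not depend on [n], so the window enters the error only as a constant. *)
Lemma card_window : (#|window| <= #|gball p rho (0%R : torus d n0) r| ^ 3 + k * D0)%N.
Proof.
rewrite (leq_trans (leq_card_setU _ _).1)// leq_add//.
  rewrite (leq_trans (leq_imset_card _ _))// !cardsX.
  by rewrite expnS expnS expn1 mulnA !leq_mul// leq_imset_card.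
by rewrite (leq_trans (leq_imset_card _ _))// cardsX card_posset -degree_size.
Qed.

Variables (a b : R).
Local Notation w := (ising_weight p rho a b).
Local Notation Z := (ising_Z p rho d n a b).

Definition copy_ratio : R := expR (2 * a) ^+ k * expR (- 2 * b * (perimeter eta)%:~R).
Definition site_ratio : R := expR (2 * a) * expR (2 * `|b| * D0%:R).

(** The window contains all neighbours of the positive sites, so cleanness isolates the copy and the
    energy lost is governed by its perimeter, which translation preserves. *)
Lemma ising_weight_clean x s : clean posset window x s ->
  w s = copy_ratio * w (unset [set x + v | v in posset]%SET s).
Proof.
move=> /forall_inP cx; set S := [set _ | _ in _]%SET.
have inW z : z \in posset -> z \in window.
  move=> /(fintype.subsetP posset_ballset) zB.
  by rewrite -[z](@subrK _ z) window_ballset.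
have cS : #|S| = k by rewrite card_imset ?card_posset//; exact: addrI.
have eS : 2 * #|[set A in edges p rho | A \subset S]%SET|%:R
    = 2 * #|[set A in edges p rho | A \subset posset]%SET|%:R :> R.
  rewrite /edges !card_edges_in;
    [|exact: adj_irr|exact: adj_sym|exact: adj_irr|exact: adj_sym].
  rewrite big_imset/=; last by move=> ? ? _ _; exact: addrI.
  apply: eq_bigr => y yV; congr (_%:R).
  rewrite -[RHS](card_imset _ (addrI x)); congr #|pred_of_set _|.
  apply/setP => z; rewrite inE /S !in_shift inE adjE [in RHS]adjE.
  by rewrite opprD addrA [z - x - y]addrAC addrAC.
rewrite (@ising_weight_unset _ _ _ _ _ _ _ _ S)//.
- by rewrite /copy_ratio perimeter_size eS cS card_posset.
- move=> y; rewrite in_shift => yV.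
  by have := cx _ (inW _ yV); rewrite yV [x + _]addrC subrK => /eqP->.
- move=> y z; rewrite !in_shift => yV zV yz.
  have zW : z - x \in window.
    rewrite inE; apply/orP; right; apply/imsetP; exists (y - x, z - y).
      by rewrite !inE yV -adjE.
    by rewrite /= [RHS]addrC addrA subrK.
  by have := cx _ zW; rewrite (negbTE zV) [x + _]addrC subrK => /eqP->.
Qed.

Lemma sum_ising_weight_pos (S : {set torus d n}) :
  \sum_(s : {ffun torus d n -> bool} | [forall x in S, s x]) w s
    <= site_ratio ^+ #|S| * Z.
Proof.
apply: sum_all_set_le => [|s|u s su]; first by rewrite mulr_ge0 ?expR_ge0.
  exact: expR_ge0.
by rewrite /site_ratio -degree_size; exact: ising_weight_unset1.
Qed.

Lemma mass_copies j : mass (distribution (ising p rho d n a b) (copies eta n)) j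
  = (\sum_(s | count_occ ballset posset s == j) w s) / Z.
Proof.
rewrite /mass /distribution /pushforward /= /ising /= mulr_suml.
apply: eq_bigl => s; apply/idP/eqP; rewrite inE /= copiesE.
  by move/eqP; rewrite eqr_nat => /eqP.
by move=> ->.
Qed.

Lemma copies_recursion j :
  `|j.+1%:R * mass (distribution (ising p rho d n a b) (copies eta n)) j.+1
    - (n ^ d)%:R * copy_ratio
      * mass (distribution (ising p rho d n a b) (copies eta n)) j|
  <= (#|gball p rho (0%R : torus d n0) r| ^ 3 + k * D0)%N%:R
     * ((n ^ d)%:R * site_ratio ^+ k + (n ^ d)%:R * copy_ratio) * site_ratio.
Proof.
have cT : #|{: torus d n}| = (n ^ d)%N by rewrite card_ffun !card_ord prednK.
have sr0 : 0 <= site_ratio by rewrite mulr_ge0 ?expR_ge0.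
have cr0 : 0 <= copy_ratio by rewrite mulr_ge0 ?exprn_ge0 ?expR_ge0.
have V0 : posset != finset.set0 by rewrite -card_gt0 card_posset.
have := @count_recursion R _ ballset posset window V0 posset_ballset
  window_ballset posset_rigid w site_ratio copy_ratio (fun s => expR_ge0 _)
  sr0 cr0 sum_ising_weight_pos ising_weight_clean j.
rewrite -/Z card_posset cT !mass_copies => h.
have Z0 : 0 < Z by exact: ising_Z_gt0.
rewrite [_ * (_ / _)]mulrA [(_ * copy_ratio) * (_ / _)]mulrA -mulrBl normrM.
rewrite [`|Z^-1|]gtr0_norm ?invr_gt0//.
rewrite ler_pdivrMr//; apply: le_trans h _; rewrite ler_pM2r// exprS.
(* One factor [site_ratio] is pulled out to carry the decay; what remains in parentheses stays
   bounded under the scaling of the theorem. *)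
have E (A W x y z : R) :
  A * W * (x * y + z * x) = W * ((A * y + A * z) * x) by ring.
rewrite {}E -[leRHS]mulrA ler_wpM2r//.
  by rewrite mulr_ge0// addr_ge0// mulr_ge0// exprn_ge0.
by rewrite ler_nat card_window.
Qed.

Lemma copies_tail J :
  1 - \sum_(j < J) mass (distribution (ising p rho d n a b) (copies eta n)) j
  <= (1 + (n ^ d)%:R * site_ratio ^+ k) / J.+1%:R.
Proof.
have cT : #|{: torus d n}| = (n ^ d)%N by rewrite card_ffun !card_ord prednK.
have sr0 : 0 <= site_ratio by rewrite mulr_ge0 ?expR_ge0.
have V0 : posset != finset.set0 by rewrite -card_gt0 card_posset.
have Z0 : 0 < Z by exact: ising_Z_gt0.
have := @count_tail R _ ballset posset posset_ballset w site_ratio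
  (fun s => expR_ge0 _) sum_ising_weight_pos J.
rewrite -/Z card_posset cT => h.
under eq_bigr do rewrite mass_copies.
rewrite -mulr_suml -[X in X - _](mulfV (lt0r_neq0 Z0)) -mulrBl ler_pdivrMr//.
by rewrite mulrAC.
Qed.

End size.
End pattern.

(** * Asymptotics in n and the Poisson limit *)

Lemma cvg0_of_pow (R : realType) (u : nat -> R) (M : R) (k : nat) :
  (0 < k)%N -> (forall n, 0 <= u n) ->
  (forall n, (0 < n)%N -> u n ^+ k * n%:R <= M) ->
  (u @ \oo --> (0 : R))%classic.
Proof.
move=> k0 u0 hu; apply/cvgrPdist_le => e e0.
near=> n; rewrite sub0r normrN ger0_norm//.
have nM : M / e ^+ k <= n%:R by near: n; exact: nbhs_infty_ger.
have n0 : (0 < n)%N by near: n; exact: nbhs_infty_gt.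
rewrite -(@ler_pXn2r _ k) ?nnegrE ?(ltW e0)// -(@ler_pM2r _ n%:R) ?ltr0n//.
by apply: le_trans (hu _ n0) _; rewrite mulrC -ler_pdivrMr ?exprn_gt0.
Unshelve. all: by end_near. Qed.

(** The integral estimate for the zero function with bound 1: its right side dominates an absolute
    value. *)
Lemma sum_mass_le1 (R : realType) (mu : probability R R) (J : nat) :
  \sum_(j < J) mass mu j <= 1.
Proof.
have := @dist_Rintegral_masses R mu (cst 0) 1 J (measurable_cst _).
move=> /(_ (fun x => _))/(le_trans (normr_ge0 _)); rewrite mul1r subr_ge0.
by apply=> x; rewrite normr0.
Qed.

Theorem theorem1p2 (R : realType) (d : nat) (p : \bar R) (rho : R)
  (r n0 : nat) (eta : local_config p rho d n0 r) (b c : R) (a : nat -> R)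
  (hd : (1 <= d)%N) (hp : (1 <= p)%E) (hrho : 0 < rho) (hr : (0 < r)%N)
  (hn0 : 2 * rho * (r%:R + 1) < n0%:R)
  (hk : (1 <= kplus eta)%N) (hc : 0 < c)
  (ha : forall n : nat, (1 <= n)%N ->
    expR (2 * a n) = c * n%:R `^ (- (d%:R / (kplus eta)%:R))) :
  weak_cvg (fun n => distribution (ising p rho d n (a n) b) (copies eta n))
    (poisson (c ^+ kplus eta * expR (- 2 * b * (perimeter eta)%:~R))).
Proof.
set k := kplus eta in hk ha *; set la := c ^+ k * _.
have la0 : 0 < la by rewrite mulr_gt0 ?exprn_gt0 ?expR_gt0.
(* The scaling of the field enters the later estimates through this exact identity, which removes
   the real power. *)
have ak n : (0 < n)%N -> expR (2 * a n) ^+ k * (n ^ d)%:R = c ^+ k.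
  move=> n_gt0; have nR : (0 : R) < (n ^ d)%:R by rewrite ltr0n expn_gt0 n_gt0.
  rewrite ha// exprMn -mulrA; rewrite -[X in c ^+ k * X = _](_ : 1 = _) ?mulr1//.
  rewrite -powR_mulrn ?powR_ge0// -powRrM mulNr divfK ?pnatr_eq0 -?lt0n//.
  by rewrite powRN powR_mulrn// -natrX mulVf// gt_eqF.
have a0 : (expR (2 * a n) @[n --> \oo] --> (0 : R))%classic.
  apply: (@cvg0_of_pow _ _ (c ^+ k) k) => // n n_gt0.
  rewrite -(ak n)// ler_wpM2l ?exprn_ge0 ?expR_ge0// ler_nat.
  by rewrite -{1}(expn1 n) leq_pexp2l.
(* The first threshold makes the ball graphs agree; the second makes the positive set rigid under
   translation. *)
have big : \forall n \near \oo%classic, [/\ 2 * rho * (r%:R + 1) < n%:R,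
    6 * (r%:R * rho) < n%:R & (0 < n)%N].
  near=> n; split; near: n;
    [exact: nbhs_infty_gtr|exact: nbhs_infty_gtr|exact: nbhs_infty_gt].
pose D := degree p rho (0 : torus d n0).
pose K : R := expR (2 * `|b| * D%:R).
have ratio n : (0 < n)%N -> (n ^ d)%:R * copy_ratio eta (a n) b = la.
  by move=> n_gt0; rewrite /copy_ratio mulrA [_%:R * _]mulrC ak.
have site n : (0 < n)%N ->
    (n ^ d)%:R * @site_ratio R p rho d n0 (a n) b ^+ k = c ^+ k * K ^+ k.
  by move=> n_gt0; rewrite /site_ratio exprMn mulrA [_%:R * _]mulrC ak.
pose P n j := mass (distribution (ising p rho d n (a n) b) (copies eta n)) j.
apply: weak_cvg_masses; last exact: sum_mass_poisson.
move=> j; rewrite mass_poisson//.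
apply: (@poisson_cvg_of_recursion R la P (1 + c ^+ k * K ^+ k)) => //.
- by move=> n i; exact: mass_ge0.
- by move=> n J; exact: sum_mass_le1.
- move=> J; near=> n.
  have [n1 n2 n3] : [/\ 2 * rho * (r%:R + 1) < n%:R,
      6 * (r%:R * rho) < n%:R & (0 < n)%N] by near: n.
  by have := copies_tail hp hrho hr hn0 hk n1 n2 (a n) b J; rewrite site.
- move=> i; set C : R := (#|gball p rho (0%R : torus d n0) r| ^ 3 + k * D)%N%:R
    * (c ^+ k * K ^+ k + la).
  (* Nothing depends on [J] here: the lemma serves as a squeeze, with e^(2a) tending to 0. *)
  apply: (@cvg0_diag _ _ (fun _ => 0) (fun _ n => C * (expR (2 * a n) * K))).
  + exact: cvg_cst.
  + move=> _; have -> : (0 : R) = C * (0 * K) by rewrite mul0r mulr0.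
    by apply: cvgM; [exact: cvg_cst|apply: cvgM => //; exact: cvg_cst].
  + move=> _; near=> n; rewrite add0r.
    have [n1 n2 n3] : [/\ 2 * rho * (r%:R + 1) < n%:R,
        6 * (r%:R * rho) < n%:R & (0 < n)%N] by near: n.
    by have := copies_recursion hp hrho hr hn0 hk n1 n2 (a n) b i; rewrite site// ratio.
Unshelve. all: by end_near. Qed.
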